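(* Let $ABC$ be an anticlockwise oriented triangle and let a circle $\Gamma$ with centre $O$ meet the sides $BC$, $CA$, $AB$ at $\{A_1,A_2\}$, $\{B_1,B_2\}$, $\{C_1,C_2\}$ respectively. Let $P$ and $Q$ be the Miquel points of $\triangle A_1B_1C_1$ and $\triangle A_2B_2C_2$ in $\triangle ABC$, respectively, and put $T_A=PA_1\cap QA_2$, $T_B=PB_1\cap QB_2$, $T_C=PC_1\cap QC_2$. Let $S_t$ be the point of $\odot(ABC)$ at which the parallels through $A,B,C$ to $T_BT_C,T_CT_A,T_AT_B$ respectively are concurrent. Then the perpendicular through $A$ to $T_BT_C$, the perpendicular through $B$ to $T_CT_A$, and the perpendicular through $C$ to $T_AT_B$ are concurrent at the antipode $T_a$ of $S_t$ in $\odot(ABC)$.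
   Context: All objects lie in the Euclidean plane; $\odot(XYZ)$ denotes the circumcircle of $\triangle XYZ$. The two labels on each side may be assigned in either order. Miquel point: if $D,E,F$ lie on the lines $BC,CA,AB$ respectively, the Miquel point of $\triangle DEF$ in $\triangle ABC$ is the common point of $\odot(AEF)$, $\odot(BFD)$, $\odot(CDE)$. The three parallels defining $S_t$ are indeed concurrent at a point of $\odot(ABC)$. The antipode of a point on a circle is the diametrically opposite point. Coincidences are read in the limiting sense: if, e.g., $B_1=A\neq C_1$, then $\odot(AB_1C_1)$ means the circle through $A$ and $C_1$ tangent to line $CA$ at $A$ (and similarly in the other cases). The configuration is assumed nondegenerate, so that every named object exists and is uniquely determined: no circle above has all three of its defining points equal, $P\neq Q$, $P\notin\{A_1,B_1,C_1\}$, $Q\notin\{A_2,B_2,C_2\}$, and the pairs of lines defining $T_A,T_B,T_C$ are distinct and not parallel. *)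

(* Defs.v *)
From Stdlib Require Import Reals Rgeom.
Open Scope R_scope.

Definition point : Type := (R * R)%type.

Definition vec (X Y : point) : point := (fst Y - fst X, snd Y - snd X).

Definition cross (u v : point) : R := fst u * snd v - snd u * fst v.

Definition dot (u v : point) : R := fst u * fst v + snd u * snd v.

Definition dist (X Y : point) : R := dist_euc (fst X) (snd X) (fst Y) (snd Y).

Definition midpoint (X Y : point) : point :=
  ((fst X + fst Y) / 2, (snd X + snd Y) / 2).

Definition anticlockwise (A B C : point) : Prop := 0 < cross (vec A B) (vec A C).

(* Lines are sets of points. [line X Y] is a genuine line only if X <> Y, and
   [parallel_through X U V], [perp_through X U V] only if U <> V. *)

Definition line (X Y : point) : point -> Prop :=
  fun Z => cross (vec X Y) (vec X Z) = 0.

Definition parallel_through (X U V : point) : point -> Prop :=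
  fun Z => cross (vec U V) (vec X Z) = 0.

Definition perp_through (X U V : point) : point -> Prop :=
  fun Z => dot (vec U V) (vec X Z) = 0.

Definition concurrent_at (l m n : point -> Prop) (X : point) : Prop :=
  forall Y, (l Y /\ m Y /\ n Y) <-> Y = X.

(* The lines XY and UV are distinct and not parallel, and Z is their
   intersection: nonzero [cross] says that the directions are independent. *)
Definition lines_meet_at (X Y U V Z : point) : Prop :=
  cross (vec X Y) (vec U V) <> 0 /\ line X Y Z /\ line U V Z.

Record circle : Type := Circle {
  center : point;
  radius : R;
  radius_pos : 0 < radius
}.

Definition on_circle (k : circle) (X : point) : Prop :=
  dist (center k) X = radius k.

Definition circumcircle (X Y Z : point) (k : circle) : Prop :=
  on_circle k X /\ on_circle k Y /\ on_circle k Z.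

Definition antipode (k : circle) (S T : point) : Prop :=
  on_circle k S /\ on_circle k T /\ midpoint S T = center k.

(* The line l and the circle k meet exactly in {X, Y}; in particular X = Y
   holds exactly when l is tangent to k. *)
Definition meets_in (l : point -> Prop) (k : circle) (X Y : point) : Prop :=
  forall Z, (l Z /\ on_circle k Z) <-> (Z = X \/ Z = Y).

Definition tangent_at (l : point -> Prop) (k : circle) (X : point) : Prop :=
  forall Z, (l Z /\ on_circle k Z) <-> Z = X.

(* k is the circle VEF, for E on the line VU and F on the line VW, in the
   limiting sense: when E (or F) coincides with V, tangency to the line
   carrying that point replaces the lost incidence.  E = F is possible only
   when both equal V, since the lines VU and VW meet only at V. *)
Definition vertex_circle (V U W E F : point) (k : circle) : Prop :=
  on_circle k V /\ on_circle k E /\ on_circle k F /\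
  (E = V -> tangent_at (line V U) k V) /\
  (F = V -> tangent_at (line V W) k V).

(* None of the circles AEF, BFD, CDE has its three defining points equal. *)
Definition nondegenerate_inscribed (A B C D E F : point) : Prop :=
  ~ (E = A /\ F = A) /\ ~ (F = B /\ D = B) /\ ~ (D = C /\ E = C).

(* With D, E, F on BC, CA, AB and [nondegenerate_inscribed A B C D E F], the
   three circles below are uniquely determined, so the existential merely
   names them. *)
Definition miquel_point (A B C D E F P : point) : Prop :=
  exists ka kb kc : circle,
    vertex_circle A C B E F ka /\
    vertex_circle B A C F D kb /\
    vertex_circle C B A D E kc /\
    concurrent_at (on_circle ka) (on_circle kb) (on_circle kc) P.

(* Main.v *)
Require Import Defs.
From Stdlib Require Import Reals Lra.
Open Scope R_scope.

(** The Miquel condition says that [P A1], [P B1], [P C1] make equal angles with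
    the sides; let [k] be the cotangent of that angle, and [k'] that for [Q].
    The midpoint of [A1 A2] is the foot of [O] on [BC], and likewise for the other
    sides; adding the inclination equations of [P] and [Q] shows that [k + k' <> 0]
    would put one point on all three side lines, so [k' = - k].  Hence [TA A1 A2]
    is isosceles and [O TA] is perpendicular to [BC].  The remaining equation for
    [TA] says that [TA] is the projection on this perpendicular of a point [O + x]
    with the same [x] for all three sides, so that [TA TB TC] is oppositely similar
    to [ABC].  If [St <> A], the right angle [St A Ta] makes [A Ta] perpendicular
    to [TB TC]; if [St = A], the similarity makes [TB TC] parallel to the tangent
    of the circumcircle at [A]. *)

(** * Vectors in coordinates *)

Ltac coords :=
  repeat match goal with X : point |- _ => destruct X end;
  unfold dot, cross, vec in *; cbn [fst snd] in *.

Lemma on_circle_dot (k : circle) (X : point) :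
  on_circle k X <-> dot (vec (center k) X) (vec (center k) X) = radius k * radius k.
Proof.
  destruct k as [c r hr]; unfold on_circle, dist, dist_euc; cbn [center radius].
  set (e := Rsqr (fst c - fst X) + Rsqr (snd c - snd X)).
  replace (dot (vec c X) (vec c X)) with e by (unfold e, Rsqr; coords; ring).
  assert (he : 0 <= e) by (apply Rplus_le_le_0_compat; apply Rle_0_sqr).
  split; intro h.
  - rewrite <- h; symmetry; apply sqrt_sqrt; exact he.
  - change (sqrt e = r); rewrite h; apply sqrt_square; lra.
Qed.

Lemma dot_self_neq0 (X Y : point) : X <> Y -> dot (vec X Y) (vec X Y) <> 0.
Proof.
  intros hXY h; apply hXY.
  destruct (Rplus_sqr_eq_0 _ _ h) as [h1 h2].
  coords; f_equal; lra.
Qed.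

Lemma cross_dot_eq0 (u v : point) :
  dot u u <> 0 -> cross u v = 0 -> dot u v = 0 -> v = (0, 0).
Proof.
  intros hu hc hd.
  assert (h1 : dot u u * fst v = 0).
  { transitivity (fst u * dot u v - snd u * cross u v); [coords; ring |].
    rewrite hc, hd; ring. }
  assert (h2 : dot u u * snd v = 0).
  { transitivity (snd u * dot u v + fst u * cross u v); [coords; ring |].
    rewrite hc, hd; ring. }
  apply Rmult_integral in h1; apply Rmult_integral in h2.
  destruct v as [x y]; cbn in h1, h2; f_equal; tauto.
Qed.

Lemma line_sym (X Y Z : point) : line X Y Z -> line Y X Z.
Proof. unfold line; intro h; coords; lra. Qed.

Lemma point_eq_dec (X Y : point) : {X = Y} + {X <> Y}.
Proof. decide equality; apply Req_EM_T. Qed.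

(** * Chords of a circle and the foot of its centre on a line *)

(** The centre lies on the perpendicular bisector of [E F], and [vec E F] is parallel to [vec X Y].
    A sum of dot products keeps its meaning when [E] and [F] merge into a point of contact. *)
Lemma secant_chord (X Y E F : point) (k : circle) :
  line X Y E -> line X Y F -> E <> F -> on_circle k E -> on_circle k F ->
  dot (vec X Y) (vec (center k) E) + dot (vec X Y) (vec (center k) F) = 0.
Proof.
  rewrite !on_circle_dot; unfold line; intros hE hF hEF kE kF.
  apply dot_self_neq0 in hEF.
  set (c := center k) in *; clearbody c.
  assert (h : dot (vec E F) (vec E F) *
    (dot (vec X Y) (vec c E) + dot (vec X Y) (vec c F)) = 0).
  { assert (h1 : cross (vec X Y) (vec E F) = 0) by (coords; lra).
    assert (h2 : dot (vec E F) (vec c E) + dot (vec E F) (vec c F) = 0) by (coords; lra).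
    transitivity (dot (vec X Y) (vec E F) *
        (dot (vec E F) (vec c E) + dot (vec E F) (vec c F))
      + cross (vec X Y) (vec E F) *
        (cross (vec c E) (vec E F) + cross (vec c F) (vec E F))).
    - clear; coords; ring.
    - rewrite h1, h2; ring. }
  apply Rmult_integral in h; tauto.
Qed.

Lemma tangent_chord (X Y E : point) (k : circle) :
  X <> Y -> tangent_at (line X Y) k E -> dot (vec X Y) (vec (center k) E) = 0.
Proof.
  intros hXY ht.
  destruct (proj2 (ht E) eq_refl) as [hl hk].
  pose proof (dot_self_neq0 _ _ hXY) as hn.
  set (d := dot (vec X Y) (vec (center k) E)).
  set (s := -2 * d / dot (vec X Y) (vec X Y)).
  (* the reflection of E in the foot of the centre is again a common point *)
  assert (hZ : (fst E + s * fst (vec X Y), snd E + s * snd (vec X Y)) = E).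
  { apply ht; split.
    - unfold line in *; rewrite <- hl; clearbody s; clear; coords; ring.
    - rewrite on_circle_dot in *; rewrite <- hk.
      assert (hs : s * dot (vec X Y) (vec X Y) + 2 * d = 0)
        by (unfold s; field; exact hn).
      match goal with |- ?l = ?r => assert (l - r = 
        s * (s * dot (vec X Y) (vec X Y) + 2 * d)) as h end.
      { unfold d; clearbody s; set (c := center k); clearbody c; clear; coords; ring. }
      rewrite hs in h; lra. }
  assert (hs : s * dot (vec X Y) (vec X Y) = 0).
  { clearbody s; destruct E as [e1 e2]; injection hZ; cbn; intros h2 h1.
    transitivity (s * fst (vec X Y) * fst (vec X Y) + s * snd (vec X Y) * snd (vec X Y));
      [unfold dot; ring |].
    replace (s * fst (vec X Y)) with 0 by (cbn; lra).
    replace (s * snd (vec X Y)) with 0 by (cbn; lra); ring. }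
  unfold s in hs; field_simplify in hs; [lra | exact hn].
Qed.

(** For [E = F], [meets_in] says tangency, so one equation serves secants and tangents alike. *)
Lemma meets_in_chord (X Y E F : point) (k : circle) :
  X <> Y -> meets_in (line X Y) k E F ->
  line X Y E /\ line X Y F /\
  dot (vec X Y) (vec (center k) E) + dot (vec X Y) (vec (center k) F) = 0.
Proof.
  intros hXY h.
  destruct (proj2 (h E) (or_introl eq_refl)) as [lE kE].
  destruct (proj2 (h F) (or_intror eq_refl)) as [lF kF].
  split; [exact lE | split; [exact lF |]].
  destruct (point_eq_dec E F) as [e | n].
  - subst F; rewrite (tangent_chord X Y E k hXY); [ring |].
    intro Z; rewrite (h Z); tauto.
  - now apply secant_chord.
Qed.

(** * Equal angles at the Miquel point *)

(** The secant and the limiting tangent case give the same equation, so later steps never ask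
    whether [E = V]. *)
Lemma vertex_circle_chord (V U W E F : point) (k : circle) :
  V <> U -> line V U E -> vertex_circle V U W E F k ->
  dot (vec V U) (vec (center k) V) + dot (vec V U) (vec (center k) E) = 0.
Proof.
  intros hVU hE (kV & kE & _ & ht & _).
  destruct (point_eq_dec E V) as [e | n].
  - subst E; rewrite (tangent_chord V U V k hVU (ht eq_refl)); ring.
  - apply secant_chord; auto; unfold line; clear; coords; ring.
Qed.

Lemma vertex_circle_sym (V U W E F : point) (k : circle) :
  vertex_circle V U W E F k -> vertex_circle V W U F E k.
Proof. unfold vertex_circle; tauto. Qed.

(** Inscribed angles on the circle through [V], [E], [F], [P]: the directed angles from [P E] to
    [V U] and from [P F] to [V W] have the same cotangent. The cross-multiplied form stays valid
    when points coincide or a side line passes through [P]. *)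
Lemma vertex_circle_equal_angles (V U W E F P : point) (k : circle) :
  V <> U -> V <> W -> line V U E -> line V W F ->
  vertex_circle V U W E F k -> on_circle k P ->
  dot (vec P E) (vec V U) * cross (vec P F) (vec V W) =
  dot (vec P F) (vec V W) * cross (vec P E) (vec V U).
Proof.
  intros hU hW hE hF hk kP.
  pose proof (vertex_circle_chord V U W E F k hU hE hk) as hdE.
  pose proof (vertex_circle_chord V W U F E k hW hF
    (vertex_circle_sym _ _ _ _ _ _ hk)) as hdF.
  destruct hk as (kV & _).
  rewrite on_circle_dot in kV, kP; unfold line in hE, hF.
  set (c := center k) in *; clearbody c.
  (* Thales: [vec P V] minus twice [vec c V] leads from [P] to the antipode of [V]. *)
  assert (hdiam : dot (vec P V) (vec P V) - 2 * dot (vec P V) (vec c V) = 0).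
  { transitivity (dot (vec c P) (vec c P) - dot (vec c V) (vec c V));
      [clear; coords; ring | rewrite kV, kP; ring]. }
  (* with V and the antipode of V as ends of a diameter, E may be replaced by
     that antipode in the dot products, and by V in the cross products *)
  assert (h : forall E U, cross (vec V U) (vec V E) = 0 ->
    dot (vec V U) (vec c V) + dot (vec V U) (vec c E) = 0 ->
    dot (vec P E) (vec V U) = dot (vec P V) (vec V U) - 2 * dot (vec V U) (vec c V)
    /\ cross (vec P E) (vec V U) = cross (vec P V) (vec V U)).
  { clear; intros; split; coords; lra. }
  destruct (h E U hE hdE) as [-> ->], (h F W hF hdF) as [-> ->].
  apply Rminus_diag_uniq.
  transitivity (cross (vec V U) (vec V W) *
    (dot (vec P V) (vec P V) - 2 * dot (vec P V) (vec c V)));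
    [clear; coords; ring | rewrite hdiam; ring].
Qed.

(** [k] is the cotangent of the angle from the line [P D] to the direction [u]. *)
Definition inclined (k : R) (P D u : point) : Prop :=
  dot (vec P D) u = k * cross (vec P D) u.

Lemma anticlockwise_neq (A B C : point) :
  anticlockwise A B C -> A <> B /\ B <> C /\ C <> A.
Proof.
  unfold anticlockwise; intro h; repeat split; intro e; subst; coords; lra.
Qed.

Lemma no_common_point (A B C Z : point) :
  anticlockwise A B C -> line B C Z -> line C A Z -> line A B Z -> False.
Proof. unfold anticlockwise, line; intros; coords; lra. Qed.

Lemma inclination_of_ratio (x1 x2 y1 y2 z1 z2 : R) :
  x1 * y2 = y1 * x2 -> x1 * z2 = z1 * x2 -> x2 <> 0 ->
  exists k, x1 = k * x2 /\ y1 = k * y2 /\ z1 = k * z2.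
Proof.
  intros h1 h2 h; exists (x1 / x2); repeat split; apply (Rmult_eq_reg_r x2); trivial;
    field_simplify; trivial; lra.
Qed.

Lemma miquel_inclined (A B C D E F P : point) :
  anticlockwise A B C -> line B C D -> line C A E -> line A B F ->
  miquel_point A B C D E F P -> P <> D -> P <> E -> P <> F ->
  exists k, inclined k P D (vec B C) /\ inclined k P E (vec C A)
    /\ inclined k P F (vec A B).
Proof.
  intros hABC lD lE lF (ka & kb & kc & ha & hb & hc & hP) nD nE nF.
  destruct (anticlockwise_neq _ _ _ hABC) as (nAB & nBC & nCA).
  destruct (proj2 (hP P) eq_refl) as (pa & pb & pc).
  assert (EF := vertex_circle_equal_angles A C B E F P ka (not_eq_sym nCA) nAB
    (line_sym _ _ _ lE) lF ha pa).
  assert (FD := vertex_circle_equal_angles B A C F D P kb (not_eq_sym nAB) nBC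
    (line_sym _ _ _ lF) lD hb pb).
  assert (DE := vertex_circle_equal_angles C B A D E P kc (not_eq_sym nBC) nCA
    (line_sym _ _ _ lD) lE hc pc).
  (* The equations use the directions leaving each vertex; these sign rules turn them into the
     cyclic directions [B C], [C A], [A B]. *)
  assert (hdot : forall X U V, dot X (vec V U) = - dot X (vec U V))
    by (clear; intros; coords; ring).
  assert (hcross : forall X U V, cross X (vec V U) = - cross X (vec U V))
    by (clear; intros; coords; ring).
  rewrite (hdot _ C A), (hcross _ C A) in EF.
  rewrite (hdot _ A B), (hcross _ A B) in FD.
  rewrite (hdot _ B C), (hcross _ B C) in DE.
  assert (hz : forall X U V, P <> X -> U <> V ->
    cross (vec P X) (vec U V) = 0 -> dot (vec P X) (vec U V) <> 0).
  { intros X U V nX nUV h0 h1.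
    apply nUV; pose proof (cross_dot_eq0 _ _ (dot_self_neq0 _ _ nX) h0 h1) as h.
    clear - h; coords; injection h; intros; f_equal; lra. }
  assert (hline : forall X U V, line U V X -> cross (vec P X) (vec U V) = 0 -> line U V P).
  { clear; unfold line; intros; coords; lra. }
  (* A vanishing cross product puts [P] on [B C]. The dot product is then nonzero, and the equal
     angles put [P] on the other two side lines as well. *)
  assert (hD : cross (vec P D) (vec B C) <> 0).
  { intro h0; apply (no_common_point A B C P hABC).
    - now apply (hline D).
    - apply (hline E); trivial; pose proof (hz D B C nD nBC h0); nra.
    - apply (hline F); trivial; pose proof (hz D B C nD nBC h0); nra. }
  unfold inclined; apply inclination_of_ratio; trivial; lra.
Qed.

(** * Opposite inclinations of the two Miquel points *)

Lemma opposite_inclinations (A B C O D D' E E' F F' P Q : point) (k k' : R) :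
  anticlockwise A B C ->
  dot (vec B C) (vec O D) + dot (vec B C) (vec O D') = 0 ->
  dot (vec C A) (vec O E) + dot (vec C A) (vec O E') = 0 ->
  dot (vec A B) (vec O F) + dot (vec A B) (vec O F') = 0 ->
  line B C D -> line C A E -> line A B F ->
  line B C D' -> line C A E' -> line A B F' ->
  inclined k P D (vec B C) -> inclined k P E (vec C A) -> inclined k P F (vec A B) ->
  inclined k' Q D' (vec B C) -> inclined k' Q E' (vec C A) -> inclined k' Q F' (vec A B) ->
  k' = - k.
Proof.
  intros hABC mD mE mF lD lE lF lD' lE' lF' iD iE iF iD' iE' iF'.
  destruct (Req_dec (k + k') 0) as [h | hk]; [lra | exfalso].
  (* On each side line, the sum of the two inclination equations becomes an equation between cross
     products once the vector 2O - P - Q is turned clockwise by a right angle. Solving it gives a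
     point of that line whose formula does not involve the side. *)
  set (Z := ((k * fst P + k' * fst Q - (snd P + snd Q - 2 * snd O)) / (k + k'),
             (k * snd P + k' * snd Q + (fst P + fst Q - 2 * fst O)) / (k + k')) : point).
  assert (h1 : (k + k') * fst Z = k * fst P + k' * fst Q - (snd P + snd Q - 2 * snd O))
    by (unfold Z; cbn; field; exact hk).
  assert (h2 : (k + k') * snd Z = k * snd P + k' * snd Q + (fst P + fst Q - 2 * fst O))
    by (unfold Z; cbn; field; exact hk).
  assert (hZ : forall U V X X', dot (vec U V) (vec O X) + dot (vec U V) (vec O X') = 0 ->
    line U V X -> line U V X' -> inclined k P X (vec U V) -> inclined k' Q X' (vec U V) ->
    line U V Z).
  { clearbody Z; clear - h1 h2 hk; unfold line, inclined; intros U V X X' m l l' i i'.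
    assert (h : (k + k') * cross (vec U V) (vec U Z) = 0);
      [| apply Rmult_integral in h; tauto].
    assert (e1 : cross (vec P X) (vec U V) = cross (vec P U) (vec U V))
      by (clear - l; coords; lra).
    assert (e2 : cross (vec Q X') (vec U V) = cross (vec Q U) (vec U V))
      by (clear - l'; coords; lra).
    rewrite e1 in i; rewrite e2 in i'; clear e1 e2 l l'.
    transitivity (fst (vec U V) * ((k + k') * snd Z) - snd (vec U V) * ((k + k') * fst Z)
      - (k + k') * cross (vec U V) U); [clear; coords; ring |].
    rewrite h1, h2; clear - m i i'; coords; lra. }
  apply (no_common_point A B C Z hABC); eapply hZ; eassumption.
Qed.

(** * Positions of the points [TA], [TB], [TC] *)

(** The inclination depends only on the line [P D]; for [T = P] both sides vanish. *)
Lemma inclined_collinear (k : R) (P D T u : point) :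
  P <> D -> line P D T -> inclined k P D u -> inclined k P T u.
Proof.
  unfold line, inclined; intros hn hl hi.
  apply dot_self_neq0 in hn.
  apply Rminus_diag_uniq.
  apply (Rmult_eq_reg_l (dot (vec P D) (vec P D))); [| exact hn].
  transitivity (dot (vec P D) (vec P T) * (dot (vec P D) u - k * cross (vec P D) u)
    + cross (vec P D) (vec P T) * (cross (vec P D) u + k * dot (vec P D) u)).
  - clear; coords; ring.
  - rewrite hl, hi; ring.
Qed.

(** [T] is the orthogonal projection of [O + x] on the perpendicular to [u]
    through [O]. *)
Definition projection (O x u T : point) : Prop :=
  dot (vec O T) u = 0 /\ cross (vec O T) u = cross x u.

(** The points [O], [P], [Q], [TA], [TB], [TC] lie on one circle, and this is the
    vector of its diameter from [O]; it is taken at [k <> 0]. *)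
Definition diameter_vec (k : R) (O P : point) : point :=
  (fst (vec O P) - snd (vec O P) / k, snd (vec O P) + fst (vec O P) / k).

Lemma meet_projection (k : R) (O P Q U V D D' T : point) :
  k <> 0 -> P <> D -> Q <> D' ->
  dot (vec U V) (vec O D) + dot (vec U V) (vec O D') = 0 ->
  line U V D -> line U V D' ->
  inclined k P D (vec U V) -> inclined (- k) Q D' (vec U V) ->
  lines_meet_at P D Q D' T -> projection O (diameter_vec k O P) (vec U V) T.
Proof.
  intros hk nD nD' m l l' i i' (_ & t & t').
  pose proof (inclined_collinear _ _ _ _ _ nD t i) as j.
  pose proof (inclined_collinear _ _ _ _ _ nD' t' i') as j'.
  unfold line, inclined in *.
  (* [T] has the same height over [D] and [D'], so the opposite inclinations make its displacements
     from them along the side cancel, while [O] projects to the midpoint of [D D']. *)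
  assert (hd : dot (vec O T) (vec U V) = 0).
  { assert (e : cross (vec P T) (vec U V) - cross (vec P D) (vec U V)
      = cross (vec Q T) (vec U V) - cross (vec Q D') (vec U V))
      by (clear - l l'; coords; lra).
    apply (f_equal (Rmult k)) in e.
    assert (s : 2 * dot (vec O T) (vec U V) = 
      dot (vec U V) (vec O D) + dot (vec U V) (vec O D')
      + (dot (vec P T) (vec U V) - dot (vec P D) (vec U V))
      + (dot (vec Q T) (vec U V) - dot (vec Q D') (vec U V)))
      by (clear; coords; ring).
    rewrite m, i, i', j, j' in s; lra. }
  split; [exact hd |].
  (* The inclination of [P T] and [hd] now express the height of [T] over [O] through [P] alone. The
     resulting dot product with [vec O P], divided by [k], is the quarter turn in [diameter_vec]. *)
  apply (Rmult_eq_reg_l k); [| exact hk].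
  transitivity (k * cross (vec P T) (vec U V) + k * cross (vec O P) (vec U V));
    [clear; coords; ring |].
  rewrite <- j.
  transitivity (dot (vec O T) (vec U V) - dot (vec O P) (vec U V)
    + k * cross (vec O P) (vec U V)); [clear; coords; ring |].
  rewrite hd; unfold diameter_vec; clear - hk; coords; field; exact hk.
Qed.

Lemma projection_eq (O x u T : point) :
  dot u u <> 0 -> projection O x u T ->
  T = (fst O + cross x u * snd u / dot u u, snd O - cross x u * fst u / dot u u).
Proof.
  intros hu [hd hc]; rewrite <- hc.
  destruct T as [t1 t2]; f_equal; apply (Rmult_eq_reg_l (dot u u)); trivial.
  - transitivity (dot u u * fst O + fst u * dot (vec O (t1, t2)) u
      + cross (vec O (t1, t2)) u * snd u); [clear; coords; ring |].
    rewrite hd; field; exact hu.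
  - transitivity (dot u u * snd O + snd u * dot (vec O (t1, t2)) u
      - cross (vec O (t1, t2)) u * fst u); [clear; coords; ring |].
    rewrite hd; field; exact hu.
Qed.

(** With points as complex numbers, [(TB - TA) / (TC - TA)] is the conjugate of
    [(B - A) / (C - A)], cleared of denominators. *)
Definition opposite_similar (A B C TA TB TC : point) : Prop :=
  dot (vec TA TB) (vec A C) = dot (vec TA TC) (vec A B) /\
  cross (vec TA TB) (vec A C) = cross (vec TA TC) (vec A B).

(** For nonzero [x], the three projections lie on the circle with diameter from [O] to [O + x]. Its
    inscribed angles equal those between the perpendiculars at [O], hence between the sides, with
    orientation reversed. *)
Lemma projections_opposite_similar (A B C O x TA TB TC : point) :
  anticlockwise A B C ->
  projection O x (vec B C) TA -> projection O x (vec C A) TB ->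
  projection O x (vec A B) TC -> opposite_similar A B C TA TB TC.
Proof.
  intros hABC hA hB hC.
  destruct (anticlockwise_neq _ _ _ hABC) as (nAB & nBC & nCA).
  apply dot_self_neq0 in nAB, nBC, nCA.
  rewrite (projection_eq _ _ _ _ nBC hA), (projection_eq _ _ _ _ nCA hB),
    (projection_eq _ _ _ _ nAB hC).
  clear - nAB nBC nCA; unfold opposite_similar; coords.
  split; field; repeat split; assumption.
Qed.

Lemma opposite_similar_rot (A B C TA TB TC : point) :
  opposite_similar A B C TA TB TC -> opposite_similar B C A TB TC TA.
Proof. unfold opposite_similar; intros [h1 h2]; split; coords; lra. Qed.

(** * Perpendiculars through the antipode *)

Lemma antipode_right_angle (A S T : point) (k : circle) :
  antipode k S T -> on_circle k A -> dot (vec A S) (vec A T) = 0.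
Proof.
  intros (kS & _ & m) kA; rewrite on_circle_dot in kS, kA; rewrite <- kS in kA.
  rewrite <- m in kA; clear - kA; unfold midpoint in kA; coords; lra.
Qed.

Lemma parallel_perp (u v w : point) :
  dot u u <> 0 -> cross v u = 0 -> dot u w = 0 -> dot v w = 0.
Proof.
  intros hu hc hd; apply (Rmult_eq_reg_l (dot u u)); [| exact hu].
  transitivity (dot v u * dot u w + cross v u * cross w u); [coords; ring |].
  rewrite hc, hd; ring.
Qed.

Lemma perp_at_vertex (A B C TA TB TC S T : point) :
  A <> B -> C <> A -> opposite_similar A B C TA TB TC ->
  parallel_through A TB TC S -> parallel_through B TC TA S ->
  parallel_through C TA TB S ->
  dot (vec A S) (vec A T) = 0 -> dot (vec B S) (vec B T) = 0 ->
  dot (vec C S) (vec C T) = 0 -> perp_through A TB TC T.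
Proof.
  unfold parallel_through, perp_through.
  intros nAB nCA [hs _] pA pB pC rA rB rC.
  destruct (point_eq_dec A S) as [e | n].
  (* The right angle at [A] now says nothing. Adding the perpendicularities obtained at [B] and [C]
     leaves exactly the difference that the dot-product half of the similarity makes zero. *)
  - subst S.
    apply not_eq_sym in nAB.
    pose proof (parallel_perp _ _ _ (dot_self_neq0 _ _ nAB) pB rB) as hB.
    pose proof (parallel_perp _ _ _ (dot_self_neq0 _ _ nCA) pC rC) as hC.
    clear - hs hB hC; coords; lra.
  - exact (parallel_perp _ _ _ (dot_self_neq0 _ _ n) pA rA).
Qed.

Theorem corollary4p1
  (A B C O : point) (Gamma : circle)
  (A1 A2 B1 B2 C1 C2 P Q TA TB TC : point)
  (omega : circle) (St Ta : point)
  (hABC : anticlockwise A B C)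
  (hO : center Gamma = O)
  (hA12 : meets_in (line B C) Gamma A1 A2)
  (hB12 : meets_in (line C A) Gamma B1 B2)
  (hC12 : meets_in (line A B) Gamma C1 C2)
  (hnd1 : nondegenerate_inscribed A B C A1 B1 C1)
  (hnd2 : nondegenerate_inscribed A B C A2 B2 C2)
  (hP : miquel_point A B C A1 B1 C1 P)
  (hQ : miquel_point A B C A2 B2 C2 Q)
  (hPQ : P <> Q)
  (hPA1 : P <> A1) (hPB1 : P <> B1) (hPC1 : P <> C1)
  (hQA2 : Q <> A2) (hQB2 : Q <> B2) (hQC2 : Q <> C2)
  (hTA : lines_meet_at P A1 Q A2 TA)
  (hTB : lines_meet_at P B1 Q B2 TB)
  (hTC : lines_meet_at P C1 Q C2 TC)
  (hTBC : TB <> TC) (hTCA : TC <> TA) (hTAB : TA <> TB)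
  (homega : circumcircle A B C omega)
  (hSt : on_circle omega St)
  (hStconc : concurrent_at (parallel_through A TB TC)
               (parallel_through B TC TA) (parallel_through C TA TB) St)
  (hTa : antipode omega St Ta) :
  concurrent_at (perp_through A TB TC)
    (perp_through B TC TA) (perp_through C TA TB) Ta.
Proof.
  destruct (anticlockwise_neq _ _ _ hABC) as (nAB & nBC & nCA).
  destruct (meets_in_chord _ _ _ _ _ nBC hA12) as (lA1 & lA2 & mA).
  destruct (meets_in_chord _ _ _ _ _ nCA hB12) as (lB1 & lB2 & mB).
  destruct (meets_in_chord _ _ _ _ _ nAB hC12) as (lC1 & lC2 & mC).
  rewrite hO in mA, mB, mC.
  destruct (miquel_inclined A B C A1 B1 C1 P) as (k & iA1 & iB1 & iC1); trivial.
  destruct (miquel_inclined A B C A2 B2 C2 Q) as (k' & iA2 & iB2 & iC2); trivial.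
  assert (hk' : k' = - k)
    by exact (opposite_inclinations A B C O A1 A2 B1 B2 C1 C2 P Q k k' hABC mA mB mC
      lA1 lB1 lC1 lA2 lB2 lC2 iA1 iB1 iC1 iA2 iB2 iC2).
  subst k'.
  (* For [k = 0] both [P A1] and [Q A2] would be perpendicular to [B C], hence parallel. *)
  assert (hk : k <> 0).
  { intro h0; destruct hTA as [hTA _]; apply hTA; apply dot_self_neq0 in nBC.
    unfold inclined in iA1, iA2; rewrite h0 in iA1, iA2.
    apply (Rmult_eq_reg_l (dot (vec B C) (vec B C))); [| exact nBC].
    transitivity (dot (vec P A1) (vec B C) * cross (vec B C) (vec Q A2)
      - dot (vec Q A2) (vec B C) * cross (vec B C) (vec P A1));
      [clear; coords; ring | rewrite iA1, iA2; ring]. }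
  assert (sim : opposite_similar A B C TA TB TC).
  { apply (projections_opposite_similar A B C O (diameter_vec k O P)); trivial.
    - now apply (meet_projection k O P Q B C A1 A2).
    - now apply (meet_projection k O P Q C A B1 B2).
    - now apply (meet_projection k O P Q A B C1 C2). }
  destruct homega as (oA & oB & oC).
  pose proof (antipode_right_angle _ _ _ _ hTa oA) as rA.
  pose proof (antipode_right_angle _ _ _ _ hTa oB) as rB.
  pose proof (antipode_right_angle _ _ _ _ hTa oC) as rC.
  destruct (proj2 (hStconc St) eq_refl) as (pA & pB & pC).
  assert (hA : perp_through A TB TC Ta) by (apply (perp_at_vertex A B C TA TB TC St); trivial).
  assert (hB : perp_through B TC TA Ta)
    by (apply (perp_at_vertex B C A TB TC TA St); trivial; now apply opposite_similar_rot).
  assert (hC : perp_through C TA TB Ta)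
    by (apply (perp_at_vertex C A B TC TA TB St); trivial;
        now apply opposite_similar_rot, opposite_similar_rot).
  assert (hT : cross (vec TB TC) (vec TC TA) <> 0).
  { (* otherwise the three parallels coincide *)
    intro h; apply hTBC.
    assert (e : (fst St + fst (vec TB TC), snd St + snd (vec TB TC)) = St).
    { apply hStconc; unfold parallel_through in *.
      clear - h pA pB pC; repeat split; coords; lra. }
    clear - e; coords; injection e; intros; f_equal; lra. }
  (* A second common point would give a nonzero vector perpendicular to both [TB TC] and [TC TA],
     against [hT]. *)
  intro Y; split; [intros (yA & yB & _) | intros ->; auto].
  unfold perp_through in *.
  assert (zA : dot (vec TB TC) (vec Ta Y) = 0) by (clear - hA yA; coords; lra).
  assert (zB : dot (vec TC TA) (vec Ta Y) = 0) by (clear - hB yB; coords; lra).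
  destruct (point_eq_dec Ta Y) as [e | n]; [auto | exfalso; apply hT].
  apply (Rmult_eq_reg_l (dot (vec Ta Y) (vec Ta Y))); [| now apply dot_self_neq0].
  transitivity (dot (vec TB TC) (vec Ta Y) * cross (vec Ta Y) (vec TC TA)
    - dot (vec TC TA) (vec Ta Y) * cross (vec Ta Y) (vec TB TC));
    [clear; coords; ring | rewrite zA, zB; ring].
Qed.
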